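(* There is an absolute constant $C<10$ (independent of the dimension) such that the following holds. Let $d\in\mathbb{N}$ and let $I\subset\mathbb{Z}^d$ be a finite frequency set with $|I|>3$ that is contained in a box of edge length $2(|I|-1)$, i.e. $\max_{j=1,\dots,d}\{\max_{\boldsymbol k\in I}k_j-\min_{\boldsymbol l\in I}l_j\}\le 2(|I|-1)$. Then there exists at least one reconstructing multiple rank-1 lattice for $I$ whose number of sampling nodes is bounded by $C|I|\ln|I|$.
   Context: For $\boldsymbol z\in\mathbb{Z}^d$, $M\in\mathbb{N}$, the rank-1 lattice is $\Lambda(\boldsymbol z,M)=\{\frac{j}{M}\boldsymbol z\bmod\boldsymbol 1: j=0,\dots,M-1\}\subset[0,1)^d$ (componentwise modulo 1). A multiple rank-1 lattice is a finite union $\bigcup_{\ell=1}^s\Lambda(\boldsymbol z_\ell,M_\ell)$ of rank-1 lattices; its elements are its sampling nodes. It is called reconstructing for $I$ if the matrix $(e^{2\pi i\boldsymbol k\cdot\boldsymbol x})$ with rows indexed by its nodes $\boldsymbol x$ and columns indexed by $\boldsymbol k\in I$ has full column rank. *)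

(* Defs.v *)
(* MathComp-Analysis over an abstract R : realType; the complex numbers are R[i]
   of mathcomp-real-closed. *)
From HB Require Import structures.
From mathcomp Require Export all_boot all_order all_algebra finmap.
From mathcomp Require Export complex.
From mathcomp Require Export reals exp trigo.

Set Implicit Arguments.
Unset Strict Implicit.
Unset Printing Implicit Defensive.

Import Order.TTheory GRing.Theory Num.Theory.
Local Open Scope ring_scope.

Definition fracpart (R : realType) (x : R) : R := x - (Num.floor x)%:~R.

Definition lattice_node (R : realType) (d : nat) (z : 'rV[int]_d) (M j : nat) :
    'rV[R]_d :=
  \row_(i < d) fracpart (j%:R / M%:R * (z 0 i)%:~R).

(* A set of nodes: coinciding points are identified, so cardinals count
   distinct nodes. *)
Definition rank1_lattice (R : realType) (d : nat) (z : 'rV[int]_d) (M : nat) :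
    {fset 'rV[R]_d} :=
  [fset lattice_node R z M (nat_of_ord j) | j in 'I_M]%fset.

Definition multiple_rank1_lattice (R : realType) (d s : nat)
    (z : 'I_s -> 'rV[int]_d) (M : 'I_s -> nat) : {fset 'rV[R]_d} :=
  (\bigcup_(l <- enum 'I_s) rank1_lattice R (z l) (M l))%fset.

Definition freq_dot (R : realType) (d : nat) (k : 'rV[int]_d) (x : 'rV[R]_d) :
    R :=
  \sum_(i < d) (k 0 i)%:~R * x 0 i.

(* e^(2 pi i t), by Euler's formula *)
Definition cexp2pi (R : realType) (t : R) : R[i] :=
  Complex (cos (2 * pi * t)) (sin (2 * pi * t)).

(* Nodes and frequencies are numbered by the duplicate-free enumerations of the
   finite sets X and I. *)
Definition fourier_matrix (R : realType) (d : nat)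
    (X : {fset 'rV[R]_d}) (I : {fset 'rV[int]_d}) :
    'M[R[i]]_(#|` X|, #|` I|) :=
  \matrix_(a < #|` X|, b < #|` I|)
    cexp2pi (freq_dot (nth 0 (enum_fset I) b) (nth 0 (enum_fset X) a)).

(* row_full says that the rank is the number of columns. *)
Definition reconstructing (R : realType) (d : nat)
    (X : {fset 'rV[R]_d}) (I : {fset 'rV[int]_d}) : bool :=
  row_full (fourier_matrix X I).

(* The neutral element of these two iterated operators is the j-th coordinate
   of some member of I, hence harmless as soon as I is nonempty. *)
Definition max_coord (d : nat) (I : {fset 'rV[int]_d}) (j : 'I_d) : int :=
  \big[Num.max/(head 0 (enum_fset I)) 0 j]_(k <- enum_fset I) k 0 j.

Definition min_coord (d : nat) (I : {fset 'rV[int]_d}) (j : 'I_d) : int :=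
  \big[Num.min/(head 0 (enum_fset I)) 0 j]_(l <- enum_fset I) l 0 j.

(* The neutral element 0 is harmless since all the differences are
   nonnegative. *)
Definition expansion (d : nat) (I : {fset 'rV[int]_d}) : int :=
  \big[Num.max/0]_(j < d) (max_coord I j - min_coord I j).

(* Main.v *)
Require Import Defs.
From mathcomp Require Import all_boot all_order all_algebra finmap.
From mathcomp Require Import complex reals exp trigo.
From mathcomp Require Import sequences unstable zify ring lra.

(* Let N = |I|. Bertrand's postulate gives a prime p with 2(N-1) < p <= 4(N-1),
   so distinct frequencies of I stay distinct modulo p. For z uniform in F_p^d,
   two distinct frequencies have the same product with z with probability 1/p;
   hence a given frequency collides with another one with probability at most
   (N-1)/p <= 1/2. Some z therefore isolates at least half of any set of
   frequencies, and by repeated halving s = floor(log2 N) + 1 vectors z isolate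
   every frequency of I at least once. Since the discrete Fourier transform on
   Lambda(z, p) recovers the coefficient of each isolated frequency, the union of
   these lattices is reconstructing. It has at most s p nodes, and as
   s <= log2 N + 1 <= (3/2) log2 N for N >= 4, this is at most
   (6 / ln 2) N ln N. *)

Set Implicit Arguments.
Unset Strict Implicit.
Unset Printing Implicit Defensive.

Import Order.TTheory GRing.Theory Num.Theory.
Local Open Scope nat_scope.

(** * Bertrand's postulate, after Erdos *)

Lemma bin_le_exp2 n k : 'C(n.+1, k) <= 2 ^ n.
Proof.
elim: n k => [|n IHn] [|k]; rewrite ?bin0 ?expn_gt0 //.
  by case: k.
by rewrite binS expnS mul2n -addnn leq_add.
Qed.

(** Induction through C(2m+2, m+1) = 2 C(2m+1, m) and (m+1) C(2m+1, m) = (2m+1) C(2m, m). *)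
Lemma exp4_le_central_bin n : 0 < n -> 4 ^ n <= 2 * n * 'C(2 * n, n).
Proof.
elim: n => // -[|n] IHn _; first by [].
have := IHn isT; set m := n.+1 => IH.
have h1 := mul_bin_diag (2 * m.+1) m.
have h2 := mul_bin_down (2 * m).+1 m.
have e1 : (2 * m.+1).-1 = (2 * m).+1 by lia.
have e2 : (2 * m).+1 - m = m.+1 by lia.
rewrite e1 in h1; rewrite /= e2 in h2.
have {}h1 : 'C(2 * m.+1, m.+1) = 2 * 'C((2 * m).+1, m) by nia.
rewrite expnS h1; nia.
Qed.

Lemma prod_primes_dvd (a b n : nat) :
  (forall p, prime p -> a <= p < b -> p %| n) ->
  \prod_(a <= p < b | prime p) p %| n.
Proof.
move=> dvdp; apply/Gauss_dvd_prod; last first.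
  by move=> p; rewrite mem_index_iota => ? /dvdp; apply.
rewrite map_id; have := filter_uniq prime (iota_uniq a (b - a)).
rewrite uniq_pairwise; apply: sub_in_pairwise (filter_all prime _) => p q pp pq /=.
by rewrite prime_coprime // dvdn_prime2.
Qed.

Lemma prime_dvd_fact p n : prime p -> (p %| n`!) = (p <= n).
Proof.
move=> pr_p; apply/idP/idP => [|le_pn]; last by rewrite dvdn_fact // prime_gt0.
elim: n => [|n IHn]; first by rewrite dvdn1 => /eqP p1; rewrite p1 in pr_p.
by rewrite factS Euclid_dvdM // => /orP[/dvdn_leq -> //|/IHn /leqW].
Qed.

(** Strong induction. An even number above 2 is not prime; for an odd number 2m+1, the primes in
    (m+1, 2m+1] all divide C(2m+1, m), which is at most 4^m. *)
Lemma primorial_le n : \prod_(0 <= p < n.+1 | prime p) p <= 4 ^ n.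
Proof.
have [k] := ubnP n; elim: k n => // k IHk [|[|[|n]]] lt_nk; try by rewrite unlock.
have [odd_n|even_n] := boolP (odd n); last first.
- have [m def_n] : exists m, n.+3 = (2 * m).+1 by exists n./2.+1; lia.
  rewrite (big_cat_nat (n := m.+2)) //=; last by lia.
  have -> : 4 ^ n.+3 = 4 ^ m.+1 * 4 ^ m by rewrite -expnD; congr (_ ^ _); lia.
  apply: leq_mul; first by apply: IHk; lia.
  apply: (@leq_trans 'C((2 * m).+1, m)); last first.
    by apply: leq_trans (bin_le_exp2 _ _) _; rewrite expnM.
  apply: dvdn_leq; first by rewrite bin_gt0; lia.
  apply: prod_primes_dvd => p pr_p p_range.
  have := bin_fact (_ : m <= (2 * m).+1); rewrite (_ : _ - m = m.+1); last by lia.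
  move=> /(_ ltac:(lia)) eq_fact.
  have : p %| (2 * m).+1`! by apply: dvdn_fact; lia.
  rewrite -eq_fact Euclid_dvdM // => /orP[//|].
  by rewrite Euclid_dvdM // !prime_dvd_fact //; lia.
- rewrite big_mkcond big_nat_recr //= -big_mkcond ifN ?muln1.
    by apply: leq_trans (IHk _ _) _; rewrite ?leq_exp2l //; lia.
  by apply/negP => /even_prime[]; lia.
Qed.

(** Legendre's formula for the factorials, the sum for [n]! being padded with zero terms up to
    2n. *)
Lemma logn_central_bin p n : prime p ->
  logn p 'C(2 * n, n) =
    \sum_(1 <= k < (2 * n).+1) ((2 * n) %/ p ^ k - 2 * (n %/ p ^ k)).
Proof.
move=> pr_p.
have eq_fact : 'C(2 * n, n) * (n`! * n`!) = (2 * n)`!.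
  have le_n2n : n <= 2 * n by lia.
  by have := bin_fact le_n2n; have -> : 2 * n - n = n by lia.
have bin_pos : 0 < 'C(2 * n, n) by rewrite bin_gt0; lia.
have : logn p 'C(2 * n, n) + (logn p n`! + logn p n`!) = logn p (2 * n)`!.
  by rewrite -eq_fact lognM ?muln_gt0 ?fact_gt0 // lognM ?fact_gt0.
rewrite !logn_fact //.
have widen : \sum_(1 <= k < n.+1) n %/ p ^ k = \sum_(1 <= k < (2 * n).+1) n %/ p ^ k.
  rewrite [RHS](big_cat_nat (n := n.+1)) //=; last by lia.
  rewrite [X in _ + X]big_nat_cond [X in _ + X]big1 ?addn0 // => k.
  move=> /andP[/andP[lt_nk _] _]; rewrite divn_small //.
  by apply: leq_trans (ltn_expl k (prime_gt1 pr_p)); lia.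
rewrite widen => /(canRL (addnK _)) ->.
rewrite -big_split /= sumnB => [|k _].
  by congr (_ - _); apply: eq_bigr => ? _; lia.
by rewrite mulnC leq_divRL ?expn_gt0 ?prime_gt0 // -mulnA mulnCA leq_mul2l leq_trunc_div.
Qed.

(** Each term of the valuation sum is at most 1, and the terms with p^k > 2n vanish. *)
Lemma pfactor_central_bin_le p n : prime p -> 0 < n ->
  p ^ logn p 'C(2 * n, n) <= 2 * n.
Proof.
move=> pr_p n_gt0; have p_gt1 := prime_gt1 pr_p.
apply: leq_trans (trunc_logP p_gt1 (_ : 0 < 2 * n)); last by lia.
rewrite leq_exp2l // logn_central_bin //; set t := trunc_log p _.
have le_t : t <= 2 * n.
  have := trunc_logP p_gt1 (_ : 0 < 2 * n); rewrite -/t => /(_ ltac:(lia)).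
  by have := ltn_expl t p_gt1; lia.
rewrite (big_cat_nat (n := t.+1)) //= [X in _ + X]big_nat_cond [X in _ + X]big1 ?addn0.
  rewrite -[leqRHS](_ : \sum_(1 <= k < t.+1) 1 = _); last first.
    by rewrite sum_nat_const_nat; lia.
  apply: leq_sum => k _.
  have pk_gt0 : 0 < p ^ k by rewrite expn_gt0; lia.
  have := divn_eq n (p ^ k); have := ltn_pmod n pk_gt0.
  have := divn_eq (2 * n) (p ^ k); have := ltn_pmod (2 * n) pk_gt0.
  nia.
move=> k /andP[/andP[lt_tk _] _]; rewrite divn_small //.
by apply: leq_trans (trunc_log_ltn _ p_gt1) _; rewrite leq_exp2l.
Qed.

(** The quotients of n and 2n by p are 1 and 2, so the first term is 2 - 2 = 0. Since p > 2, also
    p^2 >= 3p > 2n, which kills the other terms. *)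
Lemma logn_central_bin_eq0 p n : prime p -> 2 < n -> 2 * n < 3 * p -> p <= n ->
  logn p 'C(2 * n, n) = 0.
Proof.
move=> pr_p n_gt2 lt_2n_3p le_pn; rewrite logn_central_bin // big_nat_cond big1 //.
move=> [//|[|k]] _.
  have p_gt0 := prime_gt0 pr_p; rewrite expn1.
  have -> : n %/ p = 1 by have := divn_eq n p; have := ltn_pmod n p_gt0; nia.
  by have := divn_eq (2 * n) p; have := ltn_pmod (2 * n) p_gt0; nia.
rewrite divn_small //.
have p_gt2 : 2 < p by lia.
apply: leq_trans lt_2n_3p _; rewrite (expnD _ 2 k) -[leqLHS]muln1.
have pk_gt0 : 0 < p ^ k by rewrite expn_gt0 prime_gt0.
by apply: leq_mul pk_gt0; rewrite -mulnn leq_mul2r p_gt2 orbT.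
Qed.

Lemma central_bin_prod n : 0 < n ->
  'C(2 * n, n) = \prod_(0 <= p < (2 * n).+1 | prime p) p ^ logn p 'C(2 * n, n).
Proof.
move=> n_gt0; set C := 'C(_, _).
have C_gt0 : 0 < C by rewrite bin_gt0; lia.
rewrite -[LHS](partnT C_gt0) (widen_partn (m := maxn C (2 * n))) ?leq_maxl //.
rewrite (big_cat_nat (n := (2 * n).+1)) ?ltnS ?leq_maxr //=.
rewrite [X in _ * X]big_nat_cond [X in _ * X]big1 ?muln1.
  rewrite (bigID prime) /= [X in _ * X]big1 ?muln1 // => p npr_p.
  by rewrite lognE (negPf npr_p).
move=> p /andP[/andP[lt_np _] _].
have [pr_p|npr_p] := boolP (prime p); last by rewrite lognE (negPf npr_p).
have := pfactor_central_bin_le pr_p n_gt0; rewrite -/C.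
case: (logn p C) => // k le_pn; have := prime_gt0 pr_p.
have : 0 < p ^ k by rewrite expn_gt0 prime_gt0.
by move: le_pn; rewrite expnS; nia.
Qed.

Lemma pow6_le_exp2 r : 31 <= r -> r.+1 ^ 6 <= 2 ^ r.
Proof.
elim: r => // r IHr; rewrite leq_eqVlt => /predU1P[<-|lt_30r].
  by rewrite -[32]/(2 ^ 5) -expnM leq_exp2l.
rewrite [2 ^ _]expnS; apply: (@leq_trans (2 * r.+1 ^ 6)); last first.
  by rewrite leq_mul2l IHr.
(* Squaring the ratio 7/5 gives 49/25 < 2. *)
have: 5 * r.+2 ^ 3 <= 7 * r.+1 ^ 3 by rewrite !expnS !expn0; nia.
rewrite !(expnM _ 3 2) => le_cubes; nia.
Qed.

Lemma floor_sqrt_exists m : exists r, r ^ 2 <= m < r.+1 ^ 2.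
Proof.
elim: m => [|m [r /andP[le_rm lt_mr]]]; first by exists 0.
have [lt|ge] := ltnP m.+1 (r.+1 ^ 2); first by exists r; rewrite lt; lia.
by exists r.+1; rewrite ge /=; nia.
Qed.

Lemma bertrand_large n : 481 <= n -> exists2 p, prime p & n < p <= 2 * n.
Proof.
move=> n_ge; have n_gt0 : 0 < n by lia.
have [/hasP[p]|/hasPn no_prime] := boolP (has prime (index_iota n.+1 (2 * n).+1)).
  by rewrite mem_index_iota => ? ?; exists p.
have [r /andP[le_rn lt_nr]] := floor_sqrt_exists (2 * n).
(* 481 is the least n with 2n >= 31^2, and 31 is the threshold of [pow6_le_exp2]. *)
have r_ge : 31 <= r by nia.
set q := (2 * n) %/ 3; have := divn_eq (2 * n) 3; rewrite -/q.
have := ltn_pmod (2 * n) (isT : 0 < 3); set t := _ %% 3 => lt_t eq_q.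
have le_rq : r.+1 <= q.+1 by nia.
(* Prime powers dividing the central binomial coefficient are at most 2n, so
   primes above sqrt (2n) divide it at most once; those in (2n/3, n] do not
   divide it, and by assumption there are none in (n, 2n]. *)
have {}central_le : 'C(2 * n, n) <= (2 * n) ^ r.-1 * 4 ^ q.
  rewrite central_bin_prod //; set C := 'C(_, _).
  rewrite (big_cat_nat (n := q.+1)) //=; last by lia.
  rewrite (big_cat_nat (n := r.+1)) //= -mulnA.
  apply: leq_mul.
    (* Neither 0 nor 1 is prime, so at most r - 1 primes up to r contribute a factor. *)
    rewrite big_mkcond 2?big_ltn //= ?mul1n; last by lia.
    rewrite -(subn1 r) -[r - 1]/(r.+1 - 2) -prod_nat_const_nat; apply: leq_prod => p _.
    by case: ifP => [pr_p|_]; [apply: pfactor_central_bin_le | lia].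
  rewrite -[leqRHS]muln1; apply: leq_mul.
    apply: leq_trans (primorial_le q).
    rewrite [leqRHS](big_cat_nat (n := r.+1)) //= -[leqLHS]mul1n.
    apply: leq_mul; first by rewrite prodn_cond_gt0 // => p /prime_gt0.
    rewrite big_nat_cond [leqRHS]big_nat_cond.
    apply: leq_prod => p /andP[/andP[lt_rp _] pr_p].
    rewrite -[leqRHS]expn1 leq_exp2l ?prime_gt1 //.
    rewrite -ltnS -(ltn_exp2l _ _ (prime_gt1 pr_p)).
    by apply: leq_ltn_trans (pfactor_central_bin_le pr_p n_gt0) _; nia.
  rewrite big_nat_cond big1 // => p /andP[/andP[lt_qp lt_pn] pr_p].
  have [le_pn|lt_np] := leqP p n; first by rewrite logn_central_bin_eq0 //; lia.
  by have := no_prime p; rewrite mem_index_iota lt_np lt_pn pr_p => /(_ isT).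
have le_4n : 4 ^ n <= (2 * n) ^ r * 4 ^ q.
  apply: leq_trans (exp4_le_central_bin n_gt0) _.
  apply: leq_trans (leq_mul (leqnn _) central_le) _.
  by rewrite mulnA -expnS prednK //; lia.
(* As 3q <= 2n, cubing allows a factor 4^(2n) to be cancelled. *)
have {}le_4n : 4 ^ n <= ((2 * n) ^ r) ^ 3.
  have := leq_exp2r (4 ^ n) ((2 * n) ^ r * 4 ^ q) (isT : 0 < 3); rewrite le_4n expnMn.
  have -> : (4 ^ n) ^ 3 = 4 ^ n * 4 ^ (2 * n) by rewrite -expnM -expnD; congr (_ ^ _); lia.
  move=> le3.
  rewrite -(@leq_pmul2r (4 ^ (2 * n))) ?expn_gt0 //; apply: leq_trans le3 _.
  by rewrite -[(4 ^ q) ^ 3]expnM leq_mul2l leq_exp2l //; lia.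
(* Both sides now depend on r only, by r^2 <= 2n < (r+1)^2; this contradicts [pow6_le_exp2]. *)
have : 2 ^ (r * r) < (r.+1 ^ 6) ^ r.
  apply: (@leq_ltn_trans (4 ^ n)); first by rewrite -[4]/(2 ^ 2) -expnM leq_exp2l //; lia.
  apply: leq_ltn_trans le_4n _.
  rewrite (_ : (r.+1 ^ 6) ^ r = (r.+1 ^ 2) ^ (r * 3)).
    by rewrite -expnM ltn_exp2r //; lia.
  by rewrite -!expnM; congr (_ ^ _); lia.
rewrite expnM ltn_exp2r; last by lia.
by rewrite ltnNge pow6_le_exp2.
Qed.

Theorem bertrand n : 0 < n -> exists2 p, prime p & n < p <= 2 * n.
Proof.
move=> n_gt0; have [|lt_n] := leqP 481 n; first exact: bertrand_large.
(* Each prime is less than twice its predecessor and the last exceeds 480, so the first one above n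
   is at most 2n. *)
pose ps := [:: 2; 3; 5; 7; 13; 23; 43; 83; 163; 317; 631].
have /allP ps_prime : all prime ps by vm_compute.
suff /hasP[p /ps_prime pr_p] : has (fun p => n < p <= 2 * n) ps by exists p.
by rewrite /ps [has _ _]/=; lia.
Qed.

Local Open Scope ring_scope.

(** * Separating frequencies by linear forms *)

(** Translating the kernel of v along a basis vector on which v is nonzero embeds its product with F
    into the whole space: applying v recovers the scalar. *)
Lemma card_orthogonal_le (F : finFieldType) d (v : 'rV[F]_d) : v != 0 ->
  (#|[set z : 'cV[F]_d | v *m z == 0%R]| * #|F| <= #|F| ^ d)%N.
Proof.
case/rV0Pn => i v_i; set K := [set z | _].
pose g (zt : 'cV[F]_d * F) : 'cV[F]_d := zt.1 + zt.2 *: delta_mx i 0.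
have g_inj : {in setX K [set: F] &, injective g}.
  move=> [z t] [z' t'] /setXP[]; rewrite /= inE => /eqP vz0 _.
  case/setXP; rewrite /= inE => /eqP vz'0 _ eq_g.
  have := congr1 (mulmx v) eq_g; rewrite /g /= !mulmxDr vz0 vz'0 !add0r.
  rewrite -!scalemxAr -colE => /matrixP/(_ 0 0); rewrite !mxE => /(mulIf v_i) eq_t.
  by move: eq_g; rewrite /g /= eq_t => /addIr ->.
have := card_in_imset g_inj; rewrite cardsX cardsT => <-.
by apply: leq_trans (max_card _) _; rewrite card_mx muln1.
Qed.

Definition isolates (F : finFieldType) d (T : finType) (f : T -> 'rV[F]_d)
    (z : 'cV[F]_d) (k : T) : bool :=
  [forall h, (h != k) ==> (f h *m z != f k *m z)].

Lemma exists_halving (F : finFieldType) d (T : finType) (f : T -> 'rV[F]_d)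
    (J : {set T}) :
  injective f -> (2 * #|T|.-1 <= #|F|)%N ->
  exists z, (2 * #|[set k in J | ~~ isolates f z k]| <= #|J|)%N.
Proof.
move=> f_inj card_F; pose bad z := [set k in J | ~~ isolates f z k].
(* Otherwise every z is bad for more than half of J. Counting the triples (z, k, h) with a
   collision, scaled by [#|F|] to avoid division, refutes this. *)
apply/existsP; rewrite -[[exists z, _]]negbK negb_exists; apply/negP => /forallP many_bad.
have bad_le z : (#|bad z| <= \sum_(k in J) \sum_(h | h != k) (f h *m z == f k *m z))%N.
  rewrite -sum1_card [leqLHS]big_mkcond [leqRHS]big_mkcond /=; apply: leq_sum => k _.
  rewrite inE; case: (k \in J) => //=; case: ifP => //.
  rewrite negb_forall => /existsP[h]; rewrite negb_imply negbK => /andP[neq_hk eq_hk].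
  by rewrite (bigD1 h) //= eq_hk.
have pairs_le k h : h != k ->
    (\sum_(z : 'cV[F]_d) (f h *m z == f k *m z) * #|F| <= #|F| ^ d)%N.
  move=> neq_hk; rewrite -big_distrl /=.
  have /card_orthogonal_le : f h - f k != 0.
    by rewrite subr_eq0; apply: contra neq_hk => /eqP/f_inj ->.
  apply: leq_trans; rewrite leq_mul2r; apply/orP; right.
  rewrite -sum1_card [leqRHS]big_mkcond /=.
  by apply: leq_sum => z _; rewrite inE mulmxBl subr_eq0; case: eqP.
have sum_bad : (\sum_z #|bad z| * #|F| <= #|J| * #|T|.-1 * #|F| ^ d)%N.
  apply: (@leq_trans (\sum_(k in J) \sum_(h | h != k) #|F| ^ d)); last first.
    rewrite -sum_nat_const big_distrl /=; apply: leq_sum => k _.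
    rewrite sum_nat_const leq_mul2r; apply/orP; right.
    by rewrite -(cardC1 k) subset_leq_card //; apply/subsetP.
  apply: (@leq_trans (\sum_z \sum_(k in J) \sum_(h | h != k)
      (f h *m z == f k *m z) * #|F|)).
    apply: leq_sum => z _; apply: leq_trans (leq_mul (bad_le z) (leqnn _)) _.
    by rewrite big_distrl leq_sum // => k _; rewrite big_distrl.
  rewrite exchange_big leq_sum // => k _; rewrite exchange_big leq_sum // => h.
  exact: pairs_le.
have F_gt0 : (0 < #|F|)%N by apply/card_gt0P; exists 0.
(* The successor records the strict inequality, so the contradiction also covers an empty J. *)
have : (#|J|.+1 * #|F| ^ d <= 2 * \sum_z #|bad z|)%N.
  rewrite mulnC -[d in (_ ^ d)%N]muln1 -card_mx -sum_nat_const big_distrr /=.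
  by apply: leq_sum => z _; have := many_bad z; rewrite -ltnNge.
have : (0 < #|F| ^ d)%N by rewrite expn_gt0 F_gt0.
rewrite -big_distrl /= in sum_bad.
move: sum_bad; move: (\sum_z _)%N (#|F| ^ d)%N card_F F_gt0.
move: #|F| #|J| (#|T|.-1) => q j t S Q; nia.
Qed.

(** Each new vector at least halves the set of frequencies not yet isolated, so s of them exhaust a
    set of fewer than 2^s. *)
Lemma exists_isolating_tuple (F : finFieldType) d (T : finType) (f : T -> 'rV[F]_d)
    s (J : {set T}) :
  injective f -> (2 * #|T|.-1 <= #|F|)%N -> (#|J| < 2 ^ s)%N ->
  exists zs : s.-tuple 'cV[F]_d, {in J, forall k, has (isolates f ^~ k) zs}.
Proof.
move=> f_inj card_F; elim: s J => [|s IHs] J lt_J.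
  exists [tuple] => k; move: lt_J; rewrite expn0 ltnS leqn0 cards_eq0 => /eqP->.
  by rewrite inE.
have [z half] := exists_halving J f_inj card_F.
case: (IHs [set k in J | ~~ isolates f z k]); first by rewrite expnS in lt_J; lia.
move=> zs zsP; exists [tuple of z :: zs] => k Jk /=.
by have [//|bad_k] := boolP (isolates f z k); rewrite /= zsP // inE Jk.
Qed.

(** * Roots of unity and the reconstruction property *)

Lemma cexp2piD (R : realType) (x y : R) : cexp2pi (x + y) = cexp2pi x * cexp2pi y.
Proof.
rewrite /cexp2pi mulrDr cosD sinD; apply/eqP; rewrite eq_complex /=.
by rewrite eqxx addrC eqxx.
Qed.

Lemma cexp2pi1 (R : realType) : cexp2pi (1 : R) = 1.
Proof. by rewrite /cexp2pi mulr1 mulr_natl cos2pi sin2pi. Qed.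

Lemma cexp2pi0 (R : realType) : cexp2pi (0 : R) = 1.
Proof. by rewrite /cexp2pi mulr0 cos0 sin0. Qed.

Lemma cexp2piN (R : realType) (x : R) : cexp2pi (- x) = (cexp2pi x)^-1.
Proof.
have eq1 : cexp2pi (- x) * cexp2pi x = 1 by rewrite -cexp2piD addNr cexp2pi0.
have nz : cexp2pi x != 0.
  by apply: contraTneq (oner_neq0 R[i]) => x0; rewrite -eq1 x0 mulr0 eqxx.
by rewrite -[LHS](mulfK nz) eq1 mul1r.
Qed.

Lemma cexp2piMn (R : realType) (x : R) n : cexp2pi (x *+ n) = cexp2pi x ^+ n.
Proof.
elim: n => [|n IHn]; first by rewrite mulr0n expr0 cexp2pi0.
by rewrite mulrS exprS cexp2piD IHn.
Qed.

Lemma cexp2piMz (R : realType) (x : R) m : cexp2pi (x *~ m) = cexp2pi x ^ m.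
Proof.
by case: m => n; rewrite ?NegzE ?mulrNz ?cexp2piN cexp2piMn.
Qed.

Lemma cexp2pi_int (R : realType) (m : int) : cexp2pi (m%:~R : R) = 1.
Proof. by rewrite cexp2piMz cexp2pi1 exp1rz. Qed.

(** The order divides p, hence is 1 or p. Order 1 is excluded because 2 pi / p lies in (0, pi),
    where the sine is positive. *)
Lemma cexp2pi_prime_primitive (R : realType) p : prime p -> (2 < p)%N ->
  p.-primitive_root (cexp2pi (p%:R^-1 : R)).
Proof.
move=> pr_p p_gt2; set w := cexp2pi _.
have p_gt0 : 0 < p%:R :> R by rewrite ltr0n prime_gt0.
have wp1 : w ^+ p = 1.
  by rewrite -cexp2piMn -[_ *+ p]mulr_natl divff ?cexp2pi1 // gt_eqF.
have [m prim_m m_p] := prim_order_exists (prime_gt0 pr_p) wp1.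
have [m1|m_neq1] := eqVneq m 1%N; last by have <- := prime_nt_dvdP pr_p m_neq1 m_p.
have := prim_expr_order prim_m; rewrite m1 expr1 => -[_] sin_eq0.
suff : 0 < sin (2 * pi * p%:R^-1 : R) by rewrite sin_eq0 ltxx.
have pi_pos := pi_gt0 R.
apply: sin_gt0_pi; rewrite !mulr_gt0 ?invr_gt0 //=.
by rewrite ltr_pdivrMr // mulrC ltr_pM2l // ltr_nat.
Qed.

Lemma exprz_eq1_prim (F : fieldType) n (w : F) (m : int) :
  n.-primitive_root w -> (w ^ m == 1) = (n %| m)%Z.
Proof.
move=> prim_w; case: m => k; first by rewrite -exprnP -(prim_order_dvd prim_w).
by rewrite NegzE -exprnN invr_eq1 -(prim_order_dvd prim_w) dvdzE abszN.
Qed.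

Lemma sum_expr_unity (F : fieldType) n (u : F) : u ^+ n = 1 -> u != 1 ->
  \sum_(j < n) u ^+ j = 0.
Proof.
move=> un1 u_neq1; have /mulfI : u - 1 != 0 by rewrite subr_eq0.
by apply; rewrite mulr0 -subrX1 un1 subrr.
Qed.

(* Inverse discrete Fourier transform: a frequency that is alone in its residue
   class is not aliased, so its coefficient can be read off the samples. *)
Lemma aliasing_free_coef_eq0 (F : fieldType) p (w : F) (T : finType)
    (a : T -> int) (c : T -> F) (k : T) :
  p.-primitive_root w -> p%:R != 0 :> F ->
  (forall h, h != k -> ~~ (p %| a h - a k)%Z) ->
  (forall j, (j < p)%N -> \sum_h c h * w ^ (j%:Z * a h) = 0) ->
  c k = 0.
Proof.
move=> prim_w p_neq0 alone samples.
have w_neq0 : w != 0.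
  apply: contra_eq_neq (prim_expr_order prim_w) => ->.
  by rewrite expr0n (gtn_eqF (prim_order_gt0 prim_w)) eq_sym oner_neq0.
have : \sum_(j < p) w ^ (- (j%:Z * a k)) * \sum_h c h * w ^ (j%:Z * a h) = 0.
  by rewrite big1 // => j _; rewrite samples ?mulr0.
under eq_bigr do rewrite big_distrr /=.
rewrite exchange_big /= (bigD1 k) //= [X in _ + X]big1 => [|h neq_hk].
  rewrite addr0; under eq_bigr => j _.
    rewrite mulrCA -expfzDr // addNr expr0z mulr1; over.
  rewrite sumr_const card_ord -mulr_natr => /eqP.
  by rewrite mulf_eq0 (negPf p_neq0) orbF => /eqP.
transitivity (\sum_(j < p) c h * (w ^ (a h - a k)) ^+ j).
  apply: eq_bigr => j _; rewrite mulrCA -expfzDr // exprnP exprz_exp.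
  by congr (_ * _ ^ _); ring.
rewrite -big_distrr /= sum_expr_unity ?mulr0 //; last by rewrite (exprz_eq1_prim _ prim_w) alone.
by apply/eqP; rewrite exprnP exprz_exp (exprz_eq1_prim _ prim_w) dvdz_mull.
Qed.

(** The integer parts removed by [fracpart] change the dot product by an integer, which the
    exponential ignores. *)
Lemma cexp2pi_freq_dot_node (R : realType) d (k z : 'rV[int]_d) (M j : nat) :
  cexp2pi (freq_dot k (lattice_node R z M j)) =
  cexp2pi (M%:R^-1 : R) ^ (j%:Z * \sum_(i < d) k 0 i * z 0 i).
Proof.
pose fl := \sum_(i < d) k 0 i * Num.floor (j%:R / M%:R * (z 0 i)%:~R : R).
have -> : freq_dot k (lattice_node R z M j) =
    M%:R^-1 *~ (j%:Z * \sum_(i < d) k 0 i * z 0 i) - fl%:~R.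
  rewrite -mulrzr rmorphM !rmorph_sum /= !big_distrr /= -sumrB.
  apply: eq_bigr => i _; rewrite mxE /fracpart !rmorphM /=; ring.
by rewrite cexp2piD cexp2piN cexp2pi_int invr1 mulr1 cexp2piMz.
Qed.

(** * Size and members of a multiple rank-1 lattice *)

Lemma card_rank1_lattice_le (R : realType) d (z : 'rV[int]_d) (M : nat) :
  (#|` rank1_lattice R z M| <= M)%N.
Proof.
apply: leq_trans (leq_imfset_card _ _ _) _.
by rewrite -(card_uniqP (enum_finmem_uniq _)) -[leqRHS]card_ord max_card.
Qed.

Lemma card_bigfcup_le (T : choiceType) (S : Type) (r : seq S) (A : S -> {fset T}) m :
  (forall l, #|` A l| <= m)%N -> (#|` (\bigcup_(l <- r) A l)%fset| <= size r * m)%N.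
Proof.
move=> card_A; elim: r => [|l r IHr]; first by rewrite big_nil cardfs0.
rewrite big_cons mulSn; apply: leq_trans (leq_card_fsetU _ _) _.
by rewrite leq_add.
Qed.

Lemma card_multiple_rank1_lattice_le (R : realType) d s (z : 'I_s -> 'rV[int]_d) M m :
  (forall l, M l <= m)%N -> (#|` multiple_rank1_lattice R z M| <= s * m)%N.
Proof.
move=> le_M; rewrite -[s in leqRHS]size_enum_ord; apply: card_bigfcup_le => l.
exact: leq_trans (card_rank1_lattice_le _ _ _) (le_M l).
Qed.

Lemma mem_multiple_rank1_lattice (R : realType) d s (z : 'I_s -> 'rV[int]_d) M l j :
  (j < M l)%N -> lattice_node R (z l) (M l) j \in multiple_rank1_lattice R z M.
Proof.
move=> lt_j; apply/bigfcupP; exists l; first by rewrite mem_enum.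
by apply/imfsetP; exists (Ordinal lt_j).
Qed.

Lemma coord_diff_le_expansion d (I : {fset 'rV[int]_d}) k h i :
  k \in I -> h \in I -> k 0 i - h 0 i <= expansion I.
Proof.
move=> Ik Ih; apply: (le_trans (y := max_coord I i - min_coord I i)).
  apply: lerB; first exact: (le_bigmax_seq _ k xpredT (fun k : 'rV[int]_d => k 0 i)).
  exact: (ge_bigmin_seq _ h xpredT (fun k : 'rV[int]_d => k 0 i)).
exact: (le_bigmax_seq _ i xpredT (fun i => max_coord I i - min_coord I i) (mem_index_enum i)).
Qed.

(** Cubing exp(-1/5) >= 4/5 gives exp(-3/5) >= 64/125 > 1/2. The bound 3/5 is what makes 6 / ln 2
    smaller than 10. *)
Lemma ln2_gt (R : realType) : 3 / 5 < ln 2 :> R.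
Proof.
rewrite -ltr_expR lnK ?posrE //.
have := expR_ge1Dx (- (1 / 5) : R); set e := expR _ => e_ge.
have : expR (3 / 5) * e ^+ 3 = 1.
  by rewrite /e -expRM_natl -expRD -[RHS]expR0; congr expR; field.
have e3_ge : 64 / 125 <= e ^+ 3.
  have -> : 64 / 125 = (4 / 5) ^+ 3 :> R by field.
  by apply: lerXn2r; rewrite ?nnegrE ?expR_ge0 //; lra.
have := expR_gt0 (3 / 5 : R); nra.
Qed.

(** A kernel vector is the coefficient vector of a trigonometric polynomial vanishing at all nodes;
    each coefficient is killed by the samples on the one lattice that isolates its frequency. *)
Lemma reconstructing_of_isolated (R : realType) d s (z : 'I_s -> 'rV[int]_d)
    (M : 'I_s -> nat) (I : {fset 'rV[int]_d}) :
  (forall l, prime (M l)) -> (forall l, 2 < M l)%N ->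
  (forall k, k \in I -> exists l, forall h, h \in I -> h != k ->
     ~~ (M l %| \sum_(i < d) (h 0 i - k 0 i) * z l 0 i)%Z) ->
  reconstructing (multiple_rank1_lattice R z M) I.
Proof.
move=> pr_M M_gt2 isolated; rewrite /reconstructing /row_full -mxrank_tr.
set X := multiple_rank1_lattice R z M; apply: inj_row_free => c c_ker.
pose freq (b : 'I_(#|` I|)) : 'rV[int]_d := nth 0 (enum_fset I) b.
have freqI b : freq b \in I by rewrite mem_nth.
apply/rowP => b; rewrite mxE; have [l alone] := isolated _ (freqI b).
have prim_w := cexp2pi_prime_primitive R (pr_M l) (M_gt2 l).
apply: (aliasing_free_coef_eq0 (a := fun b => \sum_(i < d) freq b 0 i * z l 0 i)
          (c := fun b => c 0 b) prim_w).
- by rewrite pnatr_eq0 -lt0n prime_gt0.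
- move=> h neq_hb; rewrite -sumrB; under eq_bigr do rewrite -mulrBl.
  by apply: alone; rewrite // nth_uniq ?fset_uniq.
- move=> j lt_j; have := mem_multiple_rank1_lattice R z lt_j; rewrite -/X => Xx.
  (* Lattices may share nodes, so the matrix row is located by the index of the node in X. *)
  have lt_x := Xx; rewrite -index_mem in lt_x.
  have := congr1 (fun v : 'rV_(#|` X|) => v 0 (Ordinal lt_x)) c_ker.
  rewrite !mxE => eq0; rewrite -[RHS]eq0; apply: eq_bigr => h _.
  by rewrite !mxE nth_index // cexp2pi_freq_dot_node.
Qed.

Theorem mainTheorem4 (R : realType) :
  exists C : R, C < 10 /\
    forall (d : nat) (I : {fset 'rV[int]_d}),
      (0 < d)%N ->
      (3 < #|` I|)%N ->
      expansion I <= 2 * ((#|` I|)%:Z - 1) ->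
      exists (s : nat) (z : 'I_s -> 'rV[int]_d) (M : 'I_s -> nat),
        (0 < s)%N /\
        (forall l : 'I_s, (0 < M l)%N) /\
        reconstructing (multiple_rank1_lattice R z M) I /\
        (#|` multiple_rank1_lattice R z M|)%:R
          <= C * (#|` I|)%:R * ln ((#|` I|)%:R : R).
Proof.
have ln2_lb := ln2_gt R; have ln2_gt0 : 0 < ln 2 :> R by lra.
exists (6 / ln 2); split; first by rewrite ltr_pdivrMr //; lra.
move=> d I _ N_gt3 le_exp.
have [p pr_p /andP[lt_p le_p]] : exists2 p, prime p &
    (2 * (#|` I| - 1) < p <= 2 * (2 * (#|` I| - 1)))%N by apply: bertrand; lia.
have dvdp_int := dvdz_pcharf (pchar_Fp pr_p).
pose freq (b : 'I_(#|` I|)) : 'rV[int]_d := nth 0 (enum_fset I) b.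
have freqI b : freq b \in I by rewrite mem_nth.
pose f b : 'rV['F_p]_d := map_mx intr (freq b).
have f_inj : injective f.
  move=> b h /matrixP eq_f; apply/val_inj/eqP; rewrite -(nth_uniq 0 _ _ (fset_uniq I)) //=.
  apply/eqP/matrixP => i0 i; rewrite ord1; have := eq_f 0 i; rewrite !mxE => /eqP.
  rewrite -subr_eq0 -rmorphB /= -dvdp_int => dvd_p.
  (* A coordinate difference is divisible by p and at most 2(N-1) < p in absolute value, hence
     zero. *)
  have := coord_diff_le_expansion i (freqI b) (freqI h).
  have := coord_diff_le_expansion i (freqI h) (freqI b).
  rewrite -/(freq b) -/(freq h); move: (freq b 0 i) (freq h 0 i) dvd_p => x y.
  rewrite dvdzE /= => dvd_p; have [|/dvdn_leq/(_ dvd_p)] := posnP `|x - y|%N; lia.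
set s := (trunc_log 2 #|` I|).+1.
have card_F : (2 * #|'I_(#|` I|)|.-1 <= #|'F_p|)%N by rewrite card_ord card_Fp //; lia.
have [|zs zsP] := @exists_isolating_tuple _ _ _ f s [set: _] f_inj card_F.
  by rewrite cardsT card_ord trunc_log_ltn.
(* Residues are lifted to representatives in [0, p); divisibility by p is tested back in ['F_p]. *)
pose z (l : 'I_s) : 'rV[int]_d := \row_i (val (tnth zs l i 0))%:Z.
exists s, z, (fun=> p); split=> //; split; first by move=> _; apply: prime_gt0.
split.
  apply: reconstructing_of_isolated => [_|_|k Ik]; [by []|by lia|].
  have lt_k : (index k (enum_fset I) < #|` I|)%N by rewrite index_mem.
  have /zsP/hasP[_ /tnthP[l ->] /forallP iso] := in_setT (Ordinal lt_k).
  exists l => h Ih; have lt_h : (index h (enum_fset I) < #|` I|)%N by rewrite index_mem.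
  move=> neq_hk; have /implyP := iso (Ordinal lt_h).
  have /negPf -> : Ordinal lt_h != Ordinal lt_k.
    apply: contra neq_hk => /eqP[eq_index].
    by rewrite -(nth_index 0 Ih) eq_index nth_index.
  move=> /(_ isT); apply: contra; rewrite dvdp_int rmorph_sum /= => /eqP eq0.
  rewrite -subr_eq0 -mulmxBl; apply/eqP/matrixP => i0 j0; rewrite !ord1 !mxE.
  rewrite -[RHS]eq0; apply: eq_bigr => i _.
  by rewrite !mxE /freq /= !nth_index // rmorphM rmorphB /= -pmulrn natr_Zp.
apply: (@le_trans _ _ (s * p)%:R).
  by rewrite ler_nat card_multiple_rank1_lattice_le.
set N := #|` I| in N_gt3 le_p *.
have N_gt0 : 0 < N%:R :> R by rewrite ltr0n; lia.
have le_2N : (s.-1)%:R * ln 2 <= ln N%:R :> R.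
  rewrite mulr_natl -lnXn // ler_ln ?posrE ?exprn_gt0 // -natrX ler_nat.
  by rewrite trunc_logP //; lia.
have le_4N : 2 * ln 2 <= ln N%:R :> R.
  by rewrite mulr_natl -lnXn // ler_ln ?posrE ?exprn_gt0 // -natrX ler_nat.
(* The extra [ln 2] is at most half of ln N because N >= 4. *)
have s_le : s%:R * ln 2 <= 3 / 2 * ln N%:R :> R.
  have -> : s%:R = s.-1%:R + 1 :> R by rewrite natr1.
  by lra.
have p_le : p%:R <= 4 * N%:R :> R by rewrite -natrM ler_nat; lia.
rewrite natrM -(ler_pM2r ln2_gt0).
have -> : 6 / ln 2 * N%:R * ln N%:R * ln 2 = (3 / 2 * ln N%:R) * (4 * N%:R) :> R.
  by field; rewrite gt_eqF.
by rewrite mulrAC ler_pM // mulr_ge0 // ltW.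
Qed.
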